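(* Let $m>0$ and $n\geqslant 0$ be integers, let $G=|m|\,\overline{n}$ (the component consisting, from left to right, of $m$ sockets followed by $n$ bulbs) and let $H=\overline{n}\,|m|$ (the component consisting, from left to right, of $n$ bulbs followed by $m$ sockets). Then $$\mathcal{G}(G)=\begin{cases} n & \text{if } m \text{ is even},\\ n+(-1)^n & \text{if } m \text{ is odd},\end{cases}$$ and $$\mathcal{G}(H)=\begin{cases} n & \text{if } m \text{ is even},\\ n+1 & \text{if } m \text{ is odd}.\end{cases}$$
   Context: The ruleset CHRISTMAS LIGHTS' FIXTURE. A component is a finite (possibly empty) word, read from left to right, in two kinds of pieces: bulbs and sockets. The ruleset is impartial; the moves available in a component are: (1) choose a bulb: that bulb and every piece to its right are deleted (a quiet move); (2) choose a socket that does not have bulbs as both its left and right neighbours (either neighbour is a socket or does not exist): only that socket is deleted and the two ends are joined (a quiet move); (3) choose a socket whose left and right neighbours both exist and are bulbs: only that socket is deleted, the two ends are joined, and the same player must move again, in any component of the current disjunctive sum (a carry-on move). A player who has to move and has no move loses (normal play). A disjunctive sum of components (and nim heaps) is played by moving in exactly one summand at each move, with players alternating except for carry-on moves. A $\mathcal P$-position is one that the previous player (the one not about to move) wins; an $\mathcal N$-position is one that the next player wins. Grundy-value. $\mathcal{G}(G)\in\{0,1,2,\dots\}\cup\{\infty\}$ is defined recursively. Let $S_G$ be the set of all finite Grundy-values of components reachable from $G$ by one quiet move. Let $P_G$ be the set of nonnegative integers $j$ such that some carry-on move leads from $G$ to a component $G'$ with $\mathcal{G}(G')\neq j$ (so $\mathcal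 G(G')=\infty$ protects every $j$). Then $\mathcal{G}(G)=\operatorname{mex}(S_G\cup P_G)$, the least nonnegative integer not in $S_G\cup P_G$, and $\mathcal{G}(G)=\infty$ if $S_G\cup P_G$ contains all nonnegative integers. Equivalently, $\mathcal{G}(G)=n<\infty$ iff the sum of $G$ and a nim heap $*n$ of size $n$ is a $\mathcal P$-position, and $\mathcal{G}(G)=\infty$ iff there is no such $n$. Notation: $\overline{n}$ is a string of $n$ consecutive bulbs, $|m|$ is a string of $m$ consecutive sockets, and juxtaposition is concatenation from left to right. *)

(* Defs.v *)
From mathcomp Require Import all_boot.
From mathcomp Require Import boolp.

Set Implicit Arguments.
Unset Strict Implicit.
Unset Printing Implicit Defensive.

Inductive piece := Bulb | Socket.

Definition component := seq piece.

Definition bulbs (n : nat) : component := nseq n Bulb.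
Definition sockets (m : nat) : component := nseq m Socket.

(* A piece with [s] to its left and [t] to its right has two neighbours, and
   both of them are bulbs. *)
Definition between_bulbs (s t : component) : Prop :=
  exists s' t' : component, s = rcons s' Bulb /\ t = Bulb :: t'.

Inductive quiet_move : component -> component -> Prop :=
| Quiet_bulb (s t : component) : quiet_move (s ++ Bulb :: t) s
| Quiet_socket (s t : component) :
    ~ between_bulbs s t -> quiet_move (s ++ Socket :: t) (s ++ t).

Inductive carry_on_move : component -> component -> Prop :=
| Carry_on_socket (s t : component) :
    between_bulbs s t -> carry_on_move (s ++ Socket :: t) (s ++ t).

(* Grundy-values, and minimal excludants of possibly cofinite sets, live in
   [option nat], where [None] stands for infinity. *)
Definition mex (S : nat -> Prop) : option nat :=
  if pselect (exists n, `[< ~ S n >]) is left exS then Some (ex_minn exS)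
  else None.

Lemma mexP (S : nat -> Prop) (v : option nat) :
  mex S = v <->
  (if v is Some n then ~ S n /\ forall k, k < n -> S k else forall k, S k).
Proof.
rewrite /mex; case: pselect => [exS|nexS].
  case: ex_minnP => n /asboolP nSn minn; split=> [<-|].
    split=> // k ltkn; apply: contrapT => nSk.
    by have := minn k (introT (asboolP _) nSk); rewrite leqNgt ltkn.
  case: v => [p [nSp Sp]|allS]; last by case: nSn.
  congr Some; apply/eqP; rewrite eqn_leq minn /=; last exact/asboolP.
  by rewrite leqNgt; apply/negP => /Sp.
split=> [<- k|].
  by apply: contrapT => nSk; apply: nexS; exists k; apply/asboolP.
by case: v => [p [nSp _]|//]; case: nexS; exists p; apply/asboolP.
Qed.

Definition grundy_excluded (g : component -> option nat) (G : component)
    (j : nat) : Prop :=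
  (exists2 G', quiet_move G G' & g G' = Some j) \/
  (exists2 G', carry_on_move G G' & g G' <> Some j).

(* The recursion is run for [size G] rounds, which suffices since every move
   deletes at least one piece; the value at [fuel = 0] is only ever used for the
   empty component, which has no moves and hence value 0. The intended
   recursive equation is lemma [grundyE] below. *)
Fixpoint grundy_rec (fuel : nat) (G : component) : option nat :=
  if fuel is fuel'.+1 then mex (grundy_excluded (grundy_rec fuel') G)
  else Some 0.

Definition grundy (G : component) : option nat := grundy_rec (size G) G.

Lemma quiet_move_size (G G' : component) :
  quiet_move G G' -> size G' < size G.
Proof.
by case=> [s t|s t _]; rewrite !size_cat /= addnS ltnS // leq_addr.
Qed.

Lemma carry_on_move_size (G G' : component) :
  carry_on_move G G' -> size G' < size G.
Proof. by case=> s t _; rewrite !size_cat /= addnS. Qed.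

Lemma eq_grundy_excluded (g h : component -> option nat) (G : component) :
  (forall G', size G' < size G -> g G' = h G') ->
  grundy_excluded g G = grundy_excluded h G.
Proof.
move=> gh; apply/funext => j; apply/propext; split; case=> -[G' GG' e].
- by left; exists G'; rewrite // -gh //; apply: quiet_move_size.
- by right; exists G'; rewrite // -gh //; apply: carry_on_move_size.
- by left; exists G'; rewrite // gh //; apply: quiet_move_size.
- by right; exists G'; rewrite // gh //; apply: carry_on_move_size.
Qed.

Lemma grundy_excluded_nil (g : component -> option nat) (j : nat) :
  ~ grundy_excluded g [::] j.
Proof.
by case=> -[G' GG' _];
  [move/quiet_move_size: GG' | move/carry_on_move_size: GG'].
Qed.

Lemma mex_grundy_nil (g : component -> option nat) :
  mex (grundy_excluded g [::]) = Some 0.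
Proof. by apply/mexP; split=> //; apply: grundy_excluded_nil. Qed.

Lemma grundy_recE (fuel : nat) (G : component) :
  size G <= fuel -> grundy_rec fuel G = grundy G.
Proof.
elim/ltn_ind: fuel G => -[_|fuel IH] G; first by case: G.
rewrite /grundy; case: G => [_|x G le]; first by rewrite /= mex_grundy_nil.
rewrite /=; congr mex; apply: eq_grundy_excluded => G' ltG'.
rewrite IH //; last exact: leq_trans ltG' le.
by case: (ltngtP (size G) fuel.+1) le => //= ltG _; rewrite IH.
Qed.

Lemma grundyE (G : component) : grundy G = mex (grundy_excluded grundy G).
Proof.
case: G => [|x G]; first by rewrite mex_grundy_nil.
rewrite {1}/grundy /=; congr mex; apply: eq_grundy_excluded => G' ltG'.
by rewrite grundy_recE.
Qed.

(* Main.v *)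
Require Import Defs.
From mathcomp Require Import all_boot all_order all_algebra zify.

(** Neither |m| n-bar nor n-bar |m| ever has a socket between two bulbs, so no
   carry-on move arises and all values are ordinary mex values. Deleting a
   socket flips the parity of m, and deleting a bulb replaces n by a smaller k
   in |m| n-bar, and n-bar |m| by k-bar alone; the values follow by
   induction. *)

Set Implicit Arguments.
Unset Strict Implicit.

Import GRing.Theory.
Local Open Scope ring_scope.

Lemma nseq_cat_cons_inv (T : Type) (n : nat) (a x : T) (s t : seq T) :
  nseq n a = s ++ x :: t ->
  exists i j, [/\ n = (i + j.+1)%N, s = nseq i a, x = a & t = nseq j a].
Proof.
elim: s n => [|y s IHs] [|n] //= [].
  by move=> <- <-; exists 0%N, n.
by move=> <- /IHs[i [j [-> -> -> ->]]]; exists i.+1, j.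
Qed.

(** Every move splits the word around one piece [x]; this locates [x] in the first or the second
    block, so inverting a move reduces to two cases. *)
Lemma nseq2_cat_cons_inv (T : Type) (m n : nat) (a b x : T) (s t : seq T) :
  nseq m a ++ nseq n b = s ++ x :: t ->
  (exists i j, [/\ m = (i + j.+1)%N, s = nseq i a, x = a &
                   t = nseq j a ++ nseq n b]) \/
  (exists i j, [/\ n = (i + j.+1)%N, s = nseq m a ++ nseq i b, x = b &
                   t = nseq j b]).
Proof.
elim: m s => [|m IHm] [|y s] /=.
- by move=> e; right; apply: (@nseq_cat_cons_inv _ _ _ _ [::]).
- by move=> e; right; apply: (@nseq_cat_cons_inv _ _ _ _ (y :: s)).
- by case=> <- <-; left; exists 0%N, m.
case=> <- /IHm[] [i [j [-> -> -> ->]]].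
  by left; exists i.+1, j.
by right; exists i, j.
Qed.

Lemma nseq_rcons_inv (T : Type) (n : nat) (a x : T) (s : seq T) :
  nseq n a = rcons s x -> x = a.
Proof. by rewrite -cats1 => e; case: (nseq_cat_cons_inv e) => i [j []]. Qed.

(** Everything to the left of a socket is a socket, so its left neighbour is never a bulb. *)
Lemma sockets_bulbs_no_carry_on (m n : nat) (G : component) :
  ~ carry_on_move (sockets m ++ bulbs n) G.
Proof.
move E: (sockets m ++ bulbs n) => K KG.
case: KG E => s t [s' [t' [es _]]] e.
case: {e}(nseq2_cat_cons_inv e) => -[i [j [_ es' xE _]]] //.
by rewrite es in es'; have := nseq_rcons_inv (esym es').
Qed.

(** Here the right neighbour fails: only sockets can follow a socket. *)
Lemma bulbs_sockets_no_carry_on (m n : nat) (G : component) :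
  ~ carry_on_move (bulbs n ++ sockets m) G.
Proof.
move E: (bulbs n ++ sockets m) => K KG.
case: KG E => s t [s' [t' [_ et]]] e.
case: {e}(nseq2_cat_cons_inv e) => -[i [j []]] // _ _ _.
by rewrite et; case: j.
Qed.

Lemma sockets_bulbs_quiet (m n : nat) (G : component) :
  quiet_move (sockets m ++ bulbs n) G <->
  (exists2 k, (k < n)%N & G = sockets m ++ bulbs k) \/
  (0 < m)%N /\ G = sockets m.-1 ++ bulbs n.
Proof.
split.
  move E: (sockets m ++ bulbs n) => K KG.
  case: KG E => [s t|s t _] e;
    case: {e}(nseq2_cat_cons_inv e) => -[i [j []]] // ->.
    by move=> -> _ _; left; exists i => //; rewrite addnS ltnS leq_addr.
  move=> -> _ ->; right; rewrite addnS; split => //.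
  by rewrite /sockets nseqD catA.
case=> [[k ltkn ->]|[m_gt0 ->]].
  have -> : bulbs n = bulbs k ++ Bulb :: bulbs (n - k.+1).
    by rewrite -[Bulb :: _]/(nseq _.+1 _) -nseqD; congr nseq; lia.
  by rewrite catA; apply: Quiet_bulb.
case: m m_gt0 => // m _.
(* The leftmost socket is deleted: it has no left neighbour. *)
by apply: (@Quiet_socket [::]) => -[[|? ?] [? []]].
Qed.

Lemma bulbs_sockets_quiet (m n : nat) (G : component) :
  quiet_move (bulbs n ++ sockets m) G <->
  (exists2 k, (k < n)%N & G = bulbs k) \/
  (0 < m)%N /\ G = bulbs n ++ sockets m.-1.
Proof.
split.
  move E: (bulbs n ++ sockets m) => K KG.
  case: KG E => [s t|s t _] e;
    case: {e}(nseq2_cat_cons_inv e) => -[i [j []]] // ->.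
    by move=> -> _ _; left; exists i => //; rewrite addnS ltnS leq_addr.
  move=> -> _ ->; right; rewrite addnS; split => //.
  by rewrite /sockets -catA -nseqD.
case=> [[k ltkn ->]|[m_gt0 ->]].
  have -> : bulbs n = bulbs k ++ Bulb :: bulbs (n - k.+1).
    by rewrite -[Bulb :: _]/(nseq _.+1 _) -nseqD; congr nseq; lia.
  by rewrite -catA; apply: Quiet_bulb.
case: m m_gt0 => // m _.
(* The first socket is deleted: no bulb stands to its right. *)
by apply: Quiet_socket => -[s' [t' [_]]]; case: m.
Qed.

Lemma grundy_quietP (G : component) (v : nat) :
  (forall G', ~ carry_on_move G G') ->
  (forall G', quiet_move G G' -> grundy G' <> Some v) ->
  (forall k, (k < v)%N -> exists2 G', quiet_move G G' & grundy G' = Some k) ->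
  grundy G = Some v.
Proof.
move=> noC neqv ltv; rewrite grundyE; apply/mexP; split.
  by case=> -[G' GG']; [move/(neqv _ GG') | case: (noC _ GG')].
by move=> k /ltv; left.
Qed.

(** The involution exchanging [2i] and [2i+1], that is, nim-addition of 1; it keeps the induction
    within [nat]. *)
Definition flip (n : nat) : nat := if odd n then n.-1 else n.+1.

(** Induction on [m], then on [n]. Among [n] and [flip n], deleting a socket yields the one that is
    not claimed; deleting bulbs yields the claimed formula at each [k < n], which never repeats the
    value at [n] because [flip] is injective. *)
Lemma grundy_sockets_bulbs (m n : nat) :
  grundy (sockets m ++ bulbs n) = Some (if odd m then flip n else n).
Proof.
elim: m n => [|m IHm] n; elim/ltn_ind: n => n IHn;
  apply: grundy_quietP; try exact: sockets_bulbs_no_carry_on.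
- move=> G /sockets_bulbs_quiet[[k ltkn ->]|[]//].
  by rewrite IHn // => -[]; move: ltkn; lia.
- move=> k ltkn; exists (sockets 0 ++ bulbs k); last exact: IHn.
  by apply/sockets_bulbs_quiet; left; exists k.
- move=> G /sockets_bulbs_quiet[[k ltkn ->]|[_ ->]].
    rewrite IHn //; case=> /=; rewrite /flip; move: ltkn.
    by case: (odd m) => /=; do ?case: ifP; lia.
  by rewrite IHm /= /flip; case; case: (odd m) => /=; do ?case: ifP; lia.
move=> k ltkv; have [ekn|nekn] := eqVneq k (if odd m then flip n else n).
  exists (sockets m ++ bulbs n); last by rewrite IHm ekn.
  by apply/sockets_bulbs_quiet; right.
(* Since [flip] is its own inverse, [l] is the number of bulbs that gives value [k]. Having excluded
   the value of the socket move ensures [l < n]. *)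
pose l := if odd m.+1 then flip k else k.
have ltln : (l < n)%N.
  by move: ltkv nekn; rewrite /l /flip /=; case: (odd m) => /=; do ?case: ifP; lia.
exists (sockets m.+1 ++ bulbs l).
  by apply/sockets_bulbs_quiet; left; exists l.
by rewrite IHn //; congr Some; rewrite /l /flip /=; case: (odd m) => /=; do ?case: ifP; lia.
Qed.

Lemma grundy_bulbs (n : nat) : grundy (bulbs n) = Some n.
Proof. exact: (grundy_sockets_bulbs 0 n). Qed.

(** Deleting a bulb also removes all sockets, so these moves give exactly the values below [n] for
    every [m]. The socket move then decides between [n] and [n.+1]. *)
Lemma grundy_bulbs_sockets (m n : nat) :
  grundy (bulbs n ++ sockets m) = Some (if odd m then n.+1 else n).
Proof.
elim: m => [|m IHm]; first by rewrite cats0 grundy_bulbs.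
apply: grundy_quietP; first exact: bulbs_sockets_no_carry_on.
  move=> G /bulbs_sockets_quiet[[k ltkn ->]|[_ ->]].
    by rewrite grundy_bulbs => -[] /=; case: (odd m) => /=; lia.
  by rewrite IHm => -[] /=; case: (odd m) => /=; lia.
move=> k ltkv; have [ltkn|lenk] := ltnP k n.
  by exists (bulbs k); [apply/bulbs_sockets_quiet; left; exists k
                       | apply: grundy_bulbs].
(* What remains is [k = n] with [m] even. *)
exists (bulbs n ++ sockets m); first by apply/bulbs_sockets_quiet; right.
by rewrite IHm; congr Some; move: ltkv lenk; rewrite /=; case: (odd m) => /=; lia.
Qed.

(** The sign depends only on the parity of [n], and the predecessor in [flip] is taken only at odd
    [n], so it never truncates at 0. *)
Lemma flipE (n : nat) : (flip n)%:Z = n%:Z + (-1) ^+ n.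
Proof. by rewrite /flip -signr_odd; case: ifP => /=; lia. Qed.

Theorem theorem1 (m n : nat) (hm : (0 < m)%N) :
  omap Posz (grundy (sockets m ++ bulbs n)) =
    Some (if odd m then n%:Z + (-1) ^+ n else n%:Z) /\
  omap Posz (grundy (bulbs n ++ sockets m)) =
    Some (if odd m then n%:Z + 1 else n%:Z).
Proof.
rewrite grundy_sockets_bulbs grundy_bulbs_sockets /= -flipE.
by split; congr Some; case: (odd m) => //; lia.
Qed.
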